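(* Strong detectability strictly implies eventual strong detectability for labeled P/T nets and for finite automata. That is: every strongly detectable labeled P/T net is eventually strongly detectable, and there exists a labeled P/T net that is eventually strongly detectable but not strongly detectable; likewise, every strongly detectable finite automaton is eventually strongly detectable, and there exists a finite automaton that is eventually strongly detectable but not strongly detectable.
   Context: A labeled state-transition system (LSTS) is $\mathcal{S}=(X,T,X_0,\to,\Sigma,\ell)$ with $X$ a set of states, $T$ a set of events, $X_0\subset X$ a set of initial states, $\to\subset X\times T\times X$ a transition relation, $\Sigma$ a set of labels, and $\ell:T\to\Sigma\cup\{\epsilon\}$ a labeling function ($\epsilon$ the empty word), extended to finite and infinite event sequences by concatenation. Write $x\xrightarrow{s}x'$ for $s\in T^+$ if there is a sequence of transitions from $x$ to $x'$ with event sequence $s$. For $\sigma\in\Sigma^*$, $\mathcal{M}(\mathcal{S},\sigma)=\{x\in X\mid \exists x_0\in X_0,\exists s\in T^+: \ell(s)=\sigma,\ x_0\xrightarrow{s}x\}$, with $X_0$ additionally included when $\sigma=\epsilon$. $\mathcal{L}^\omega(\mathcal{S})$ is the set of $\sigma\in\Sigma^\omega$ such that $\sigma=\ell(t_1t_2\dots)$ for some $t_1t_2\dots\in T^\omega$ for which there are states $x_0,x_1,\dots$ with $x_0\in X_0$ and $(x_i,t_{i+1},x_{i+1})\in\to$ for all $i\in\mathbb{N}$. $\mathcal{S}$ is strongly detectable if there is a positive integer $k$ such that for every $\sigma\in\mathcal{L}^\omega(\mathcal{S})$, $|\mathcal{M}(\mathcal{S},\sigma')|=1$ for every finite prefix $\sigma'$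 of $\sigma$ with $|\sigma'|>k$. $\mathcal{S}$ is eventually strongly detectable if for every $\sigma\in\mathcal{L}^\omega(\mathcal{S})$ there is a positive integer $k_\sigma$ such that $|\mathcal{M}(\mathcal{S},\sigma')|=1$ for every finite prefix $\sigma'$ of $\sigma$ with $|\sigma'|>k_\sigma$. A finite automaton is an LSTS with $X,T,\Sigma$ finite. A labeled P/T net is $G=(N,M_0,\Sigma,\ell)$, where $N=(P,T,Pre,Post)$ is a net ($P$, $T$ finite disjoint sets of places and transitions, $P\cup T\neq\emptyset$, $Pre,Post:P\times T\to\mathbb{N}$), $M_0\in\mathbb{N}^P$ is the initial marking, $\Sigma$ a finite alphabet and $\ell:T\to\Sigma\cup\{\epsilon\}$. It is viewed as an LSTS with state set $\mathbb{N}^P$ (markings), event set $T$, initial state set $\{M_0\}$, and transitions $(M,t,M')$ whenever $M(p)\ge Pre(p,t)$ and $M'(p)=M(p)-Pre(p,t)+Post(p,t)$ for all $p\in P$. *)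

(* Defs.v *)
From mathcomp Require Import all_boot.
From mathcomp Require Import classical_sets cardinality.

Set Implicit Arguments.
Unset Strict Implicit.
Unset Printing Implicit Defensive.

Local Open Scope classical_set_scope.
Local Open Scope card_scope.

(* [label t = None] encodes an unobservable event, i.e. one labeled by the
   empty word. *)
Record lsts := LSTS {
  state : Type;
  event : Type;
  init : set state;
  trans : state -> event -> state -> Prop;
  alphabet : Type;
  label : event -> option alphabet
}.

Section Detectability.
Variable S : lsts.

Fixpoint run (x : state S) (s : seq (event S)) (x' : state S) : Prop :=
  match s with
  | [::] => x = x'
  | t :: s' => exists2 y, trans x t y & run y s' x'
  end.

(* [pmap] drops the unobservable events, so this is the extension of the
   labeling to finite event sequences by concatenation. *)
Definition labels (s : seq (event S)) : seq (alphabet S) := pmap (@label S) s.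

Definition current_states (w : seq (alphabet S)) : set (state S) :=
  [set x | (exists x0 s, [/\ init x0, s <> [::], labels s = w & run x0 s x])
           \/ (w = [::] /\ init x)].

Definition is_prefix (A : Type) (w : seq A) (sigma : nat -> A) : Prop :=
  w = mkseq sigma (size w).

(* [sigma] is the concatenation of the labels of [tau 0, tau 1, ...]. The
   second clause says that infinitely many events of [tau] are observable, so
   that this concatenation is an infinite word. *)
Definition omega_labels (tau : nat -> event S) (sigma : nat -> alphabet S) :
    Prop :=
  (forall n, is_prefix (labels (mkseq tau n)) sigma) /\
  (forall m, exists n, m <= size (labels (mkseq tau n))).

(* [tau i] is the event taken from the [i]-th to the [i.+1]-st state. *)
Definition omega_language : set (nat -> alphabet S) :=
  [set sigma | exists (tau : nat -> event S) (x : nat -> state S),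
     [/\ omega_labels tau sigma, init (x 0)
       & forall i, trans (x i) (tau i) (x i.+1)]].

Definition strongly_detectable : Prop :=
  exists2 k : nat, 0 < k &
    forall sigma, omega_language sigma ->
    forall w, is_prefix w sigma -> k < size w -> current_states w #= `I_1.

Definition eventually_strongly_detectable : Prop :=
  forall sigma, omega_language sigma ->
  exists2 k : nat, 0 < k &
    forall w, is_prefix w sigma -> k < size w -> current_states w #= `I_1.

Definition finite_automaton : Prop :=
  [/\ finite_set [set: state S], finite_set [set: event S]
    & finite_set [set: alphabet S]].

End Detectability.

(* Places and transitions are disjoint since they form distinct types. *)
Record labeled_net := LabeledNet {
  place : finType;
  transition : finType;
  net_nonempty : 0 < #|place| + #|transition|;
  Pre : place -> transition -> nat;
  Post : place -> transition -> nat;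
  initial_marking : {ffun place -> nat};
  net_alphabet : finType;
  net_label : transition -> option net_alphabet
}.

(* The subtraction is never truncated, by the first clause. *)
Definition fires (G : labeled_net) (M : {ffun place G -> nat})
    (t : transition G) (M' : {ffun place G -> nat}) : Prop :=
  (forall p, Pre p t <= M p) /\ (forall p, M' p = M p - Pre p t + Post p t).

Definition lsts_of_net (G : labeled_net) : lsts :=
  {| state := {ffun place G -> nat};
     event := transition G;
     init := [set initial_marking G];
     trans := @fires G;
     alphabet := net_alphabet G;
     label := @net_label G |}.

(* Main.v *)
Require Import Defs.
From mathcomp Require Import all_boot.
From mathcomp Require Import boolp classical_sets cardinality.

(** Both examples are the same system: from the initial state [x] one can loop
    with label [a], or move with label [b] either to the deadlock [y] or to a
    state [z] that allows only a loop labeled [a].  The infinite words are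
    [a^omega] and [a^n b a^omega].  The current state is ambiguous only
    immediately after [b], so each word is eventually unambiguous, but the
    ambiguity can occur arbitrarily late. *)

Set Implicit Arguments.
Unset Strict Implicit.
Unset Printing Implicit Defensive.

Local Open Scope classical_set_scope.
Local Open Scope card_scope.

(** The uniform bound serves as the bound of each word. This holds in any LSTS, hence for nets and
    finite automata alike. *)
Lemma strongly_detectable_eventually (S : lsts) :
  strongly_detectable S -> eventually_strongly_detectable S.
Proof. by case=> k k0 H sigma Hs; exists k => // w; apply: H. Qed.

(** A bijection onto [I_1] sends both points to 0. This is used to refute detectability by
    exhibiting two distinct current states. *)
Lemma card_eq_I1_inj (T : Type) (A : set T) (u v : T) :
  A #= `I_1 -> A u -> A v -> u = v.
Proof.
move=> /card_bijP[f /bij_inj f_inj] Au Av.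
have eq_f : f (SigSub (mem_set Au)) = f (SigSub (mem_set Av)).
  apply: val_inj => /=.
  case: (f _) => i /= /set_mem /=; case: (f _) => j /= /set_mem /=.
  by case: i j => [|i] [|j].
by have /(congr1 val) := f_inj _ _ eq_f.
Qed.

(** Hiding the event behind its label lets one argument treat the automaton and the net, whose
    events differ. *)
Definition step (S : lsts) (u : state S) (c : alphabet S) (v : state S) :=
  exists2 t, label t = Some c & trans u t v.

(** * Systems in which every event is observable *)

Section FullyObservable.
Variable S : lsts.
Hypothesis observable : forall t : event S, label t <> None.

Lemma labels_rcons (s : seq (event S)) (t : event S) (c : alphabet S) :
  label t = Some c -> labels (rcons s t) = rcons (labels s) c.
Proof.
by move=> tc; rewrite /labels -!cats1 pmap_cat /= tc.
Qed.

Lemma run_rcons (u : state S) (s : seq (event S)) (t : event S) (v : state S) :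
  run u (rcons s t) v <-> exists2 w, run u s w & trans w t v.
Proof.
elim: s u => [|t' s IHs] u /=.
  by split=> [[w tr <-]|[w -> tr]]; [exists u | exists v].
split=> [[w tr /IHs[w' rs tr']]|[w' [w tr rs] tr']].
  by exists w' => //; exists w.
by exists w => //; apply/IHs; exists w'.
Qed.

(** A nonempty run would produce at least one letter. *)
Lemma current_states_nil : current_states [::] = @init S.
Proof.
apply/seteqP; split=> u /=; last by right.
case=> [[u0 [s [_ sne lab _]]]|[]//].
case: s sne lab => // t s _; rewrite /labels /=.
by case E: (label t) => //; case: (observable E).
Qed.

(** The recursion of the subset construction: the last event of a run carries exactly the last
    letter of its word. *)
Lemma current_states_rcons (w : seq (alphabet S)) (c : alphabet S) :
  current_states (rcons w c) = [set v | exists2 u, current_states w u & step u c v].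
Proof.
apply/seteqP; split=> v /=.
  case=> [[u0 [s [u0i sne lab rs]]]|[]]; last by case: w.
  case/lastP: s sne lab rs => // s t _ lab /run_rcons[u rs tr].
  case tc: (label t) lab => [d|]; last by case: (observable tc).
  rewrite (labels_rcons _ tc) => /rcons_inj[lab cd]; exists u; last first.
    by exists t; rewrite // tc cd.
  case: s lab rs => [|t' s] lab rs; last by left; exists u0, (t' :: s).
  by right; rewrite -lab -rs.
case=> u [[u0 [s [u0i sne lab rs]]]|[wnil u0i]] [t tc tr]; left.
  exists u0, (rcons s t); split=> //; first by case: (s).
    by rewrite (labels_rcons _ tc) lab.
  by apply/run_rcons; exists u.
exists u, [:: t]; split=> //; last by exists v.
by rewrite wnil /labels /= tc.
Qed.

(** No event is erased, so [n] events give [n] letters and the two sequences align index by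
    index. *)
Lemma omega_labelsP (tau : nat -> event S) (sigma : nat -> alphabet S) :
  omega_labels tau sigma <-> forall i, label (tau i) = Some (sigma i).
Proof.
split=> [[pre _] i|eq_lab].
  have size_lab n : size (labels (mkseq tau n)) = n.
    elim: n => // n IHn; rewrite mkseqS.
    case tc: (label (tau n)) => [c|]; last by case: (observable tc).
    by rewrite (labels_rcons _ tc) size_rcons IHn.
  have := pre i.+1; rewrite /is_prefix size_lab !mkseqS.
  case tc: (label (tau i)) => [c|]; last by case: (observable tc).
  by rewrite (labels_rcons _ tc) => /rcons_inj[_ ->].
have labE n : labels (mkseq tau n) = mkseq sigma n.
  by elim: n => // n IHn; rewrite !mkseqS (labels_rcons _ (eq_lab n)) IHn.
by split=> [n|m]; [rewrite /is_prefix | exists m]; rewrite labE size_mkseq.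
Qed.

Lemma omega_languageP (sigma : nat -> alphabet S) :
  omega_language sigma <->
  exists2 xs, init (xs 0) & forall i, @step S (xs i) (sigma i) (xs i.+1).
Proof.
split=> [[tau [xs [/omega_labelsP lab xs0 tr]]]|[xs xs0 st]].
  by exists xs => // i; exists (tau i).
(* Each [step] only asserts that some event exists; choice collects these into one event
   sequence. *)
have /choice[tau tauP] i : exists t,
    label t = Some (sigma i) /\ trans (xs i) t (xs i.+1).
  by case: (st i) => t; exists t.
exists tau, xs; split=> //; last by move=> i; case: (tauP i).
by apply/omega_labelsP => i; case: (tauP i).
Qed.

(** * The common behavior of the two examples *)

Section DelayedAmbiguity.
Variables (x y z : state S) (a b : alphabet S).
Hypotheses (xz : x <> z) (yz : y <> z) (ab : a <> b).
Hypothesis init_x : @init S = [set x].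
Hypothesis step_x : forall c v,
  @step S x c v <-> (c = a /\ v = x) \/ (c = b /\ (v = y \/ v = z)).
Hypothesis step_y : forall c v, ~ @step S y c v.
Hypothesis step_z : forall c v, @step S z c v <-> c = a /\ v = z.

Lemma delayed_ambiguity_eventually : eventually_strongly_detectable S.
Proof.
move=> sigma /omega_languageP[xs]; rewrite init_x => xs0 st.
(* An infinite run never enters the deadlock [y]. *)
have xs_xz n : xs n = x \/ xs n = z.
  elim: n => [|n [IHn|IHn]]; first by left.
    have := st n; rewrite IHn => /step_x[[_]|[_ [|]]]; [by left| |by right].
    by move=> xsy; have := st n.+1; rewrite xsy => /step_y.
  by have := st n; rewrite IHn => /step_z[_]; right.
have z_stays n : xs n = z -> sigma n = a /\ xs n.+1 = z.
  by move=> xsn; have := st n; rewrite xsn => /step_z.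
have cur_x n : xs n = x -> current_states (mkseq sigma n) = [set x].
  elim: n => [_|n IHn xsn]; first by rewrite current_states_nil.
  case: (xs_xz n) => xsn'; last by case: xz; rewrite -xsn; case: (z_stays n).
  rewrite mkseqS current_states_rcons IHn //.
  have sn : sigma n = a.
    have := st n; rewrite xsn' xsn => /step_x[[]//|[_ [xy|//]]].
    (* Here [x = y] is impossible because the run continues from [xs n.+1 = x]. *)
    by have := st n.+1; rewrite xsn xy => /step_y.
  rewrite sn; apply/seteqP; split=> v /=.
    by case=> _ -> /step_x[[]//|[/ab]].
  by move=> ->; exists x => //; apply/step_x; left.
(* The bound by [y] and [z] covers both the prefix ending in [b], where both occur, and all later
   ones. *)
have cur_yz n : xs n = z ->
    current_states (mkseq sigma n) z /\
    current_states (mkseq sigma n) `<=` [set y; z].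
  elim: n => [xs0z|n IHn xsn]; first by case: xz; rewrite -xs0 xs0z.
  rewrite mkseqS current_states_rcons; case: (xs_xz n) => xsn'.
    have := st n; rewrite xsn' xsn => stz; rewrite cur_x //.
    have sn : sigma n = b by case/step_x: stz => [[_ /esym/xz]|[]].
    split=> [|v [_ ->]]; first by exists x.
    by rewrite sn => /step_x[[/esym/ab]//|[]].
  have [sn _] := z_stays _ xsn'; have [curz curS] := IHn xsn'.
  split=> [|v [u /curS[]->]]; first by exists z => //; apply/step_z.
    by move/step_y.
  by case/step_z => _ ->; right.
(* One more letter eliminates [y], which has no successor. *)
have cur_z n : xs n = z -> current_states (mkseq sigma n.+1) = [set z].
  move=> xsn; have [sn _] := z_stays _ xsn; have [curz curS] := cur_yz _ xsn.
  rewrite mkseqS current_states_rcons; apply/seteqP; split=> v /=.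
    by case=> u /curS[]-> => [/step_y|/step_z[]].
  by move=> ->; exists z => //; apply/step_z.
(* Either the run reaches [z], giving a bound that depends on when, or it stays in [x] forever and
   every prefix is unambiguous. *)
have [[n xsn]|nz] := pselect (exists n, xs n = z).
  exists n.+1 => // w -> ; rewrite size_mkseq.
  case: (size w) => // m; rewrite ltnS => nm.
  suff /cur_z -> : xs m = z by exact: card_set1.
  rewrite -(subnKC (ltnW nm)); elim: (m - n) => [|i IHi]; first by rewrite addn0.
  by rewrite addnS; case: (z_stays _ IHi).
exists 1 => // w -> _; rewrite cur_x; first exact: card_set1.
by case: (xs_xz (size w)) => // xsz; case: nz; exists (size w).
Qed.

Lemma delayed_ambiguity_not_strongly : ~ strongly_detectable S.
Proof.
case=> k _ H.
(* The word is [a^k b a^omega]: its prefix of length [k.+1], just above the supposed bound, ends in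
   [b] and leaves both [y] and [z] possible. *)
pose sigma i := if i == k then b else a.
have langs : omega_language sigma.
  apply/omega_languageP; exists (fun i => if i <= k then x else z).
    by rewrite leq0n init_x.
  move=> i; rewrite /sigma; case: ltngtP => [_|_|_].
  - by apply/step_x; left.
  - by apply/step_z.
  - by apply/step_x; right; split=> //; right.
have cur_x n : n <= k -> current_states (mkseq sigma n) x.
  elim: n => [_|n IHn nk]; first by rewrite current_states_nil init_x.
  rewrite mkseqS current_states_rcons; exists x; first exact: IHn (ltnW nk).
  by apply/step_x; left; rewrite /sigma ltn_eqF.
have card1 : current_states (mkseq sigma k.+1) #= `I_1.
  by apply: H langs _ _ _; rewrite /is_prefix size_mkseq.
have cur v : v = y \/ v = z -> current_states (mkseq sigma k.+1) v.
  move=> vyz; rewrite mkseqS current_states_rcons; exists x; first exact: cur_x.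
  by apply/step_x; right; rewrite /sigma eqxx.
by apply: yz; apply: card_eq_I1_inj card1 _ _; apply: cur; [left|right].
Qed.

End DelayedAmbiguity.
End FullyObservable.

(* The states [None], [Some false], [Some true] are [x], [y], [z]; the labels [true],
   [false] are [a], [b]. *)
Definition delayed_automaton : lsts :=
  {| state := option bool;
     event := bool;
     init := [set None];
     trans := fun u t v =>
       match u, t, v with
       | None, true, None => True
       | None, false, Some _ => True
       | Some true, true, Some true => True
       | _, _, _ => False
       end;
     alphabet := bool;
     label := @Some bool |}.

Lemma delayed_automaton_finite : finite_automaton delayed_automaton.
Proof.
split.
- exact: (@finite_finset (option bool)).
- exact: (@finite_finset bool).
- exact: (@finite_finset bool).
Qed.

Lemma delayed_automaton_step (u v : state delayed_automaton) (c : bool) :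
  @step delayed_automaton u c v <-> @trans delayed_automaton u c v.
Proof. by split=> [[_ [->]]|]; last exists c. Qed.

Lemma delayed_automaton_separates :
  eventually_strongly_detectable delayed_automaton /\
  ~ strongly_detectable delayed_automaton.
Proof.
have obs (t : event delayed_automaton) : label t <> None by [].
have sx c v : @step delayed_automaton None c v <->
    (c = true /\ v = None) \/ (c = false /\ (v = Some false \/ v = Some true)).
  rewrite delayed_automaton_step.
  by case: c v => [] [[]|] /=; split; intuition congruence.
have sy c v : ~ @step delayed_automaton (Some false) c v.
  by rewrite delayed_automaton_step; case: c v => [] [[]|].
have sz c v : @step delayed_automaton (Some true) c v <->
    c = true /\ v = Some true.
  rewrite delayed_automaton_step.
  by case: c v => [] [[]|] /=; split; intuition congruence.
by split; [apply: (delayed_ambiguity_eventually obs _ _ _ sx sy sz)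
          |apply: (delayed_ambiguity_not_strongly obs _ _ sx sz)].
Qed.

Lemma unit_option_bool_nonempty : 0 < #|{: unit}| + #|{: option bool}|.
Proof. by rewrite card_unit. Qed.

(* On a single place with two initial tokens, the states [x], [y], [z] are the
   markings with [2], [0], [1] tokens.  The loop [None] keeps one token, and
   [Some i] turns two tokens into [i]. *)
Definition delayed_net : labeled_net :=
  @LabeledNet unit (option bool) unit_option_bool_nonempty
    (fun _ t => if t is Some _ then 2 else 1)
    (fun _ t => if t is Some i then nat_of_bool i else 1)
    [ffun=> 2] bool (fun t => Some (~~ isSome t)).

(** Label [true] needs one token and [false] needs two, so [m] equal to 2, 0, 1 gives the required
    behavior of [x], [y], [z]. *)
Lemma delayed_net_step (m : nat) (c : bool) (v : {ffun unit -> nat}) :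
  @step (lsts_of_net delayed_net) [ffun=> m] c v <->
  if c then 0 < m /\ v = [ffun=> m]
  else 1 < m /\ (v = [ffun=> m - 2] \/ v = [ffun=> m - 1]).
Proof.
(* With a single place, a marking is determined by one number. *)
have eqv k : v tt = k <-> v = [ffun=> k].
  split=> [vk|->]; last by rewrite ffunE.
  by apply/ffunP => -[]; rewrite ffunE.
split=> [[t [<-] [/(_ tt) + /(_ tt)]]|]; rewrite ?ffunE.
  case: t => [[]|] /= m_ge /eqv; last by rewrite subnK.
    by rewrite addn1 subnSK //; split=> //; right.
  by rewrite addn0; split=> //; left.
case: c => [[m_ge ->]|[m_ge [->|->]]].
- by exists None => //; split=> -[]; rewrite !ffunE //= subnK.
- by exists (Some false) => //; split=> -[]; rewrite !ffunE //= addn0.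
- by exists (Some true) => //; split=> -[]; rewrite !ffunE //= addn1 subnSK.
Qed.

Lemma delayed_net_separates :
  eventually_strongly_detectable (lsts_of_net delayed_net) /\
  ~ strongly_detectable (lsts_of_net delayed_net).
Proof.
pose N := lsts_of_net delayed_net.
pose tokens (m : nat) : state N := [ffun=> m].
have tokens_inj m n : tokens m = tokens n -> m = n.
  by move/ffunP/(_ tt); rewrite !ffunE.
have obs (t : event N) : label t <> None by [].
have sx c v : @step N (tokens 2) c v <->
    (c = true /\ v = tokens 2) \/
    (c = false /\ (v = tokens 0 \/ v = tokens 1)).
  by rewrite delayed_net_step; case: c; split; intuition (done || congruence).
have sy c v : ~ @step N (tokens 0) c v.
  by rewrite delayed_net_step; case: c => -[].
have sz c v : @step N (tokens 1) c v <-> c = true /\ v = tokens 1.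
  by rewrite delayed_net_step; case: c; split; intuition (done || congruence).
have xz : tokens 2 <> tokens 1 by move/tokens_inj.
have yz : tokens 0 <> tokens 1 by move/tokens_inj.
by split; [apply: (delayed_ambiguity_eventually obs xz _ _ sx sy sz)
          |apply: (delayed_ambiguity_not_strongly obs yz _ sx sz)].
Qed.

Theorem proposition6 :
  [/\ forall G : labeled_net,
        strongly_detectable (lsts_of_net G) ->
        eventually_strongly_detectable (lsts_of_net G),
      exists G : labeled_net,
        eventually_strongly_detectable (lsts_of_net G) /\
        ~ strongly_detectable (lsts_of_net G),
      forall A : lsts, finite_automaton A ->
        strongly_detectable A -> eventually_strongly_detectable A
    & exists A : lsts,
        [/\ finite_automaton A, eventually_strongly_detectable A
          & ~ strongly_detectable A]].
Proof.
split.
- by move=> G; apply: strongly_detectable_eventually.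
- by exists delayed_net; apply: delayed_net_separates.
- by move=> A _; apply: strongly_detectable_eventually.
- exists delayed_automaton; have [ev nst] := delayed_automaton_separates.
  by split=> //; apply: delayed_automaton_finite.
Qed.
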